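(* For an integer $n\ge 2$ and scalars $u,v$, let $T_n(u,v)$ denote the $n\times n$ tridiagonal matrix $$T_n(u,v)=\begin{pmatrix} u & v & & & & \\ 1 & x+1+q & q & & & \\ & 1 & x+1+q & q^{2} & & \\ & & 1 & \ddots & \ddots & \\ & & & \ddots & \ddots & q^{n-2}\\ & & & & 1 & x+1+q \end{pmatrix},$$ i.e. the $(1,1)$ entry is $u$, the $(1,2)$ entry is $v$, the $(i,i)$ entry is $x+1+q$ for $2\le i\le n$, the $(i,i+1)$ entry is $q^{i-1}$ for $2\le i\le n-1$, the $(i+1,i)$ entry is $1$ for $1\le i\le n-1$, and all other entries are $0$. Then for every $n\ge 2$: (a) $b_n(x,q)=\det T_n(x+q,\;q)$. (b) $B_n(x,q)=\det T_n(x+1+q,\;q)$. (c) $C_n(x,q)=\det T_n(x+1+q,\;1+q)$. (d) $c_n(x,q)=\det T_n(x+1+q+q^2,\;q)$. (e) $G_n(x,q)=\det T_n(1,\;0)$.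
   Context: Here $x,q$ are complex numbers with $q\neq 1$. Each of the sequences $b_n,B_n,C_n,c_n,G_n$ satisfies $M_{n}(x,q)=(x+1+q)M_{n-1}(x,q)-q^{n-2}M_{n-2}(x,q)$ for $n\ge 2$, with initial conditions: $b_0=q,\ b_1=x+q$ (first kind $q$-Morgan-Voyce); $B_0=q,\ B_1=x+1+q$ (second kind $q$-Morgan-Voyce); $C_0=1+q,\ C_1=x+1+q$ (first kind $q$-Horadam-Morgan-Voyce); $c_0=q,\ c_1=x+1+q+q^2$ (second kind $q$-Horadam-Morgan-Voyce); $G_0=0,\ G_1=1$ (Fibonacci type $q$-Morgan-Voyce). *)

(* Defs.v *)
From mathcomp Require Import all_boot all_order all_algebra.
From mathcomp Require Import reals.
From mathcomp Require Import complex.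

Set Implicit Arguments.
Unset Strict Implicit.
Unset Printing Implicit Defensive.

Import GRing.Theory.
Local Open Scope ring_scope.

Section QMorganVoyce.
Variables (K : comNzRingType) (x q : K).

(* With n = k + 2, the recurrence's coefficient q ^ (n - 2) is q ^+ k. *)
Fixpoint qMV_rec (M0 M1 : K) (n : nat) : K :=
  match n with
  | 0 => M0
  | 1 => M1
  | (k.+1 as m).+1 =>
      (x + 1 + q) * qMV_rec M0 M1 m - q ^+ k * qMV_rec M0 M1 k
  end.

(* First and second kind q-Morgan-Voyce: b_n and B_n. *)
Definition qMV_first : nat -> K := qMV_rec q (x + q).
Definition qMV_second : nat -> K := qMV_rec q (x + 1 + q).

(* First and second kind q-Horadam-Morgan-Voyce: C_n and c_n. *)
Definition qHMV_first : nat -> K := qMV_rec (1 + q) (x + 1 + q).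
Definition qHMV_second : nat -> K := qMV_rec q (x + 1 + q + q ^+ 2).

(* Fibonacci type q-Morgan-Voyce: G_n. *)
Definition qMV_fib : nat -> K := qMV_rec 0 1.

(* Indices are 0-based: the 1-based superdiagonal entry q ^ (i - 1) in
   position (i, i + 1), i >= 2, is q ^+ i in position (i, i.+1), i >= 1. *)
Definition qMV_tridiag (n : nat) (u v : K) : 'M[K]_n :=
  \matrix_(i < n, j < n)
    if i == j :> nat then (if i == 0%N :> nat then u else x + 1 + q)
    else if j == i.+1 :> nat then (if i == 0%N :> nat then v else q ^+ i)
    else if i == j.+1 :> nat then 1
    else 0.

End QMorganVoyce.

(* Main.v *)
(** Expanding a tridiagonal determinant along its last row and then the last
    column of the off-diagonal minor gives a three-term recurrence in the
    size. For [qMV_tridiag] this is the recurrence of the sequences, and it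
    holds down to size 2 because each [v] is the initial value [M_0]. *)
Require Import Defs.
From mathcomp Require Import all_boot all_order all_algebra.
From mathcomp Require Import reals.
From mathcomp Require Import complex.

Set Implicit Arguments.
Unset Strict Implicit.
Unset Printing Implicit Defensive.

Import GRing.Theory.
Local Open Scope ring_scope.
Local Open Scope complex_scope.

(** Entries come from one function on [nat], so the leading blocks of all sizes share the same
    [f]. *)
Lemma det_tridiag_rec (K : comNzRingType) (f : nat -> nat -> K) (n : nat) :
    (forall i j, (i.+1 < j)%N -> f i j = 0) ->
    (forall i j, (j.+1 < i)%N -> f i j = 0) ->
  \det (\matrix_(i < n.+2, j < n.+2) f i j) =
    f n.+1 n.+1 * \det (\matrix_(i < n.+1, j < n.+1) f i j)
    - f n.+1 n * f n n.+1 * \det (\matrix_(i < n, j < n) f i j).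
Proof.
move=> fU fL.
have bump_lt h k : (k < h)%N -> bump h k = k by move=> kh; rewrite /bump leqNgt kh.
rewrite (expand_det_row _ ord_max) 2!big_ord_recr /= big1 => [|j _]; last first.
  by rewrite mxE fL ?mul0r //= ltnS.
rewrite add0r !mxE /= addrC /cofactor; congr (_ * _ + _).
  rewrite /= addnn -signr_odd odd_double expr0 mul1r.
  congr (\det _); apply/matrixP=> i j; rewrite !mxE /=.
  by rewrite !bump_lt.
rewrite /= addSn addnn -signr_odd /= odd_double expr1 mulN1r mulrN -mulrA.
congr (- (_ * _)).
(* With column [n] deleted, the last column of this minor is the original column [n.+1], where only
   row [n] can be nonzero. *)
rewrite (expand_det_col _ ord_max) big_ord_recr /= big1 => [|i _]; last first.
  have lt_in := ltn_ord i.
  rewrite !mxE /= bump_lt; last exact: leqW lt_in.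
  by rewrite /bump leqnn fU ?mul0r.
rewrite add0r !mxE /= bump_lt // {1}/bump leqnn add1n.
rewrite /cofactor /= addnn -signr_odd odd_double expr0 mul1r.
congr (_ * \det _); apply/matrixP=> i j; rewrite !mxE /=.
by rewrite !bump_lt // ltnS ltnW.
Qed.

(** Here [v] acts as [M_0] and [u] as [M_1]. Sizes start at 1: the empty determinant is 1, not
    [v]. *)
Lemma det_qMV_tridiag (K : comNzRingType) (x q u v : K) (n : nat) :
  \det (qMV_tridiag x q n.+1 u v) = qMV_rec x q v u n.+1.
Proof.
pose f (i j : nat) : K :=
  if i == j then (if i == 0%N then u else x + 1 + q)
  else if j == i.+1 then (if i == 0%N then v else q ^+ i)
  else if i == j.+1 then 1 else 0.
have fU i j : (i.+1 < j)%N -> f i j = 0.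
  move=> ij; have le_ij := ltnW (ltnW ij).
  by rewrite /f (ltn_eqF (ltnW ij)) (gtn_eqF ij) ltn_eqF.
have fL i j : (j.+1 < i)%N -> f i j = 0.
  move=> ji; have le_ji := ltnW (ltnW ji).
  by rewrite /f (gtn_eqF (ltnW ji)) (gtn_eqF ji) ltn_eqF.
have E m : qMV_tridiag x q m u v = \matrix_(i < m, j < m) f i j by [].
have fdiag m : f m.+1 m.+1 = x + 1 + q by rewrite /f eqxx.
have fsub m : f m.+1 m = 1.
  by rewrite /f eqxx gtn_eqF // ltn_eqF.
have fsup m : f m m.+1 = if m == 0%N then v else q ^+ m.
  by rewrite /f eqxx ltn_eqF.
have det1 : \det (qMV_tridiag x q 1 u v) = u by rewrite det_mx11 mxE.
(* The recurrence has order two, so the induction carries two consecutive sizes. *)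
have [] : \det (qMV_tridiag x q n.+1 u v) = qMV_rec x q v u n.+1 /\
          \det (qMV_tridiag x q n.+2 u v) = qMV_rec x q v u n.+2; last by [].
elim: n => [|n [IH1 IH2]]; split=> //.
  (* At size 2 the superdiagonal entry [v] times the empty determinant 1 matches [q ^+ 0 * M_0]. *)
  rewrite E det_tridiag_rec // -!E fdiag fsub fsup det1 det_mx00 /=.
  by rewrite !mul1r mulr1.
by rewrite E det_tridiag_rec // -!E fdiag fsub fsup IH1 IH2 mul1r.
Qed.

Theorem corollary23 (R : realType) (x q : R[i]) (hq : q != 1)
    (n : nat) (hn : (2 <= n)%N) :
  [/\ qMV_first x q n = \det (qMV_tridiag x q n (x + q) q),
      qMV_second x q n = \det (qMV_tridiag x q n (x + 1 + q) q),
      qHMV_first x q n = \det (qMV_tridiag x q n (x + 1 + q) (1 + q)),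
      qHMV_second x q n = \det (qMV_tridiag x q n (x + 1 + q + q ^+ 2) q)
    & qMV_fib x q n = \det (qMV_tridiag x q n 1 0)].
Proof.
(* In each case [u] and [v] are the initial values [M_1] and [M_0], so both sides become
   convertible. *)
by case: n hn => // n _; split; rewrite det_qMV_tridiag.
Qed.
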